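(* Let $S=\{3^x+2^y : x,y\in\mathbb{Z}_{\ge 0}\}$. There do not exist integers $a$ and $d$ with $d\neq 0$ such that $a+kd\in S$ for all $k=0,1,\dots,6$. In other words, every arithmetic progression with nonzero common difference all of whose terms lie in $S$ has at most six terms.
   Context: $\mathbb{Z}_{\ge 0}$ denotes the set of nonnegative integers. An arithmetic progression of length $L$ is a sequence $a, a+d, \dots, a+(L-1)d$ of integers; here the common difference $d$ is required to be nonzero. *)

(* Defs.v *)
From Stdlib Require Import ZArith.
Open Scope Z_scope.

(* [x] and [y] are required to be nonnegative because [Z.pow] is 0 at negative exponents. *)
Definition sumset (n : Z) : Prop :=
  exists x y : Z, 0 <= x /\ 0 <= y /\ n = 3 ^ x + 2 ^ y.

Definition progression_in_sumset (a d : Z) (L : nat) : Prop :=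
  forall k : nat, (k < L)%nat -> sumset (a + Z.of_nat k * d).

(* Main.v *)
Require Import Defs.
From Stdlib Require Import ZArith Lia.
Open Scope Z_scope.

(** Let [t_k = a + k d] with [d > 0]. Congruences modulo 2, 3 and 8 together with the bound
    [a >= 2] force [24 | d]; then the parity of [x] is the same in all terms [3^x + 2^y], except
    possibly when [y = 1], and that of [y] is the same, except possibly when [x = 0]. Outside these
    exceptions two distinct powers of 3 (of 2) differ by a factor at least 9 (4), so that no three
    of [t_2, ..., t_6] share their power of 3, or their power of 2. On the other hand these terms all
    exceed [t_6 / 3], so each of them essentially contains one of the few powers comparable to
    [t_6]; no arrangement of these powers is compatible with equal spacing. *)

(** * Powers with exponent of prescribed parity *)

Definition pow_par (b r n : Z) : Prop := exists x, 0 <= x /\ x mod 2 = r /\ n = b ^ x.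

(* [q = 2] is the exception modulo 8, [p = 1] the exception modulo 3. *)
Definition shape (r s t : Z) : Prop :=
  exists p q, t = p + q /\
    (pow_par 3 r p /\ pow_par 2 s q
     \/ pow_par 3 (1 - r) p /\ q = 2
     \/ p = 1 /\ pow_par 2 (1 - s) q).

Lemma pow_gap b n x y :
  1 < b -> 0 <= n -> 0 <= x -> x + n <= y -> b ^ n * b ^ x <= b ^ y.
Proof.
  intros Hb Hn Hx Hy. rewrite <- Z.pow_add_r by lia.
  apply Z.pow_le_mono_r; lia.
Qed.

Lemma pow_lt_gap b x y : 1 < b -> 0 <= x -> 0 <= y -> b ^ x < b ^ y -> b * b ^ x <= b ^ y.
Proof.
  intros Hb Hx Hy H. apply Z.pow_lt_mono_r_iff in H; try lia.
  rewrite <- (Z.pow_1_r b) at 1. apply pow_gap; lia.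
Qed.

Lemma pow_par_pos b r n : 1 < b -> pow_par b r n -> 0 < n.
Proof. intros Hb (x & Hx & _ & ->). apply Z.pow_pos_nonneg; lia. Qed.

Lemma pow_par_lt_gap b r m n : 1 < b -> pow_par b r m -> pow_par b r n -> m < n -> b ^ 2 * m <= n.
Proof.
  intros Hb (x & Hx & Hxr & ->) (y & Hy & Hyr & ->) H.
  apply Z.pow_lt_mono_r_iff in H; try lia.
  apply pow_gap; try lia. Z.to_euclidean_division_equations; lia.
Qed.

(** The exponents differ by an odd number, so by 1 or by at least 3. *)
Lemma pow_par_opp_gap b r m n : 1 < b -> pow_par b r m -> pow_par b (1 - r) n ->
  n = b * m \/ b * n = m \/ b ^ 3 * m <= n \/ b ^ 3 * n <= m.
Proof.
  intros Hb (x & Hx & Hxr & ->) (y & Hy & Hyr & ->).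
  assert (y = x + 1 \/ x = y + 1 \/ x + 3 <= y \/ y + 3 <= x) as [-> | [-> | [H | H]]]
    by (Z.to_euclidean_division_equations; lia).
  - left. rewrite Z.pow_add_r by lia. lia.
  - right; left. rewrite (Z.pow_add_r b y) by lia. lia.
  - right; right; left. apply pow_gap; lia.
  - right; right; right. apply pow_gap; lia.
Qed.

(** Descent from a power above [n], two exponents at a time; it cannot reach [k = 0], as
    [b ^ r <= b <= n]. *)
Lemma pow_par_top b r n : 1 < b -> r = 0 \/ r = 1 -> b <= n ->
  exists m, pow_par b r m /\ m <= n < b ^ 2 * m.
Proof.
  intros Hb Hr Hn.
  assert (H : forall k, 0 <= k -> n < b ^ (r + 2 * k) ->
    exists m, pow_par b r m /\ m <= n < b ^ 2 * m).
  { apply (natlike_ind (fun k => n < b ^ (r + 2 * k) ->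
      exists m, pow_par b r m /\ m <= n < b ^ 2 * m)).
    - intros H. exfalso. destruct Hr as [-> | ->]; simpl in H; lia.
    - intros k Hk IH H. destruct (Z_lt_le_dec n (b ^ (r + 2 * k))) as [H' | H']; [auto |].
      exists (b ^ (r + 2 * k)). repeat split; trivial.
      + exists (r + 2 * k). repeat split; try lia.
        Z.to_euclidean_division_equations; lia.
      + rewrite <- Z.pow_add_r by lia. replace (2 + (r + 2 * k)) with (r + 2 * Z.succ k) by lia.
        exact H. }
  apply (H n); [lia |].
  apply Z.lt_le_trans with (b ^ n); [apply Z.pow_gt_lin_r; lia | apply Z.pow_le_mono_r; lia].
Qed.

(* Rescaled by [M], a term takes one of finitely many values up to small errors; the membership facts
   kept on the right are what [three_share_pow3] and [three_share_pow2] need. *)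
Lemma shape_near_top r s t M A B :
  pow_par 3 r A -> pow_par 2 s B -> A <= M < 9 * A -> B <= M < 4 * B -> t <= M -> 100 <= M ->
  shape r s t ->
  exists p q, t = p + q /\ 0 < p /\ 0 < q /\
    ((p = A /\ pow_par 2 s q \/ 9 * p <= A) /\
       (q = B /\ pow_par 3 r p \/ 4 * q = B \/ 16 * q <= B)
     \/ q = 2 /\ (p = 3 * A \/ 3 * p = A \/ 27 * p <= A)
     \/ p = 1 /\ (q = 2 * B \/ 2 * q = B \/ 8 * q <= B)).
Proof.
  intros HA HB MA MB Ht HM (p & q & E & H). exists p, q.
  assert (P3 : forall u p, pow_par 3 u p -> 0 < p) by (intros; eapply pow_par_pos; eauto; lia).
  assert (P2 : forall u p, pow_par 2 u p -> 0 < p) by (intros; eapply pow_par_pos; eauto; lia).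
  destruct H as [[Hp Hq] | [[Hp ->] | [-> Hq]]].
  - pose proof (P3 _ _ Hp). pose proof (P2 _ _ Hq).
    repeat split; trivial. left. split.
    + destruct (Z.lt_trichotomy p A) as [h | [-> | h]]; [| auto |].
      * apply (pow_par_lt_gap 3 r) in h; auto; lia.
      * apply (pow_par_lt_gap 3 r) in h; auto; lia.
    + destruct (Z.lt_trichotomy q B) as [h | [-> | h]]; [| auto |].
      * destruct Hq as (y & Hy & Hys & ->). destruct HB as (z & Hz & Hzs & ->).
        apply Z.pow_lt_mono_r_iff in h; try lia. right.
        (* [B / 4] is not negligible against [M], so exponent gap 2 is kept apart from the even gaps
           from 4 on. *)
        assert (z = 2 + y \/ y + 4 <= z) as [-> | h'] by (Z.to_euclidean_division_equations; lia).
        -- left. rewrite Z.pow_add_r by lia. lia.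
        -- right. apply (pow_gap 2 4); lia.
      * apply (pow_par_lt_gap 2 s) in h; auto; lia.
  - pose proof (P3 _ _ Hp). repeat split; try lia. right; left. split; trivial.
    pose proof (pow_par_opp_gap 3 r A p ltac:(lia) HA Hp). lia.
  - pose proof (P2 _ _ Hq). repeat split; try lia. right; right. split; trivial.
    pose proof (pow_par_opp_gap 2 s B q ltac:(lia) HB Hq). lia.
Qed.

(** * Shared powers against equal spacing *)

(** [w - v >= 8 * v > 8 * (v - u) >= 8 * d], whereas [w - v = (k - j) * d <= 5 * d]. *)
Lemma three_share_pow2 a d r B i j k u v w :
  0 < d -> 0 <= i -> i < j -> j < k -> k <= 6 ->
  a + i * d = u + B -> a + j * d = v + B -> a + k * d = w + B ->
  pow_par 3 r u -> pow_par 3 r v -> pow_par 3 r w -> False.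
Proof.
  intros.
  assert (0 < u) by (eapply (pow_par_pos 3); eauto; lia).
  assert (3 ^ 2 * v <= w) by (eapply pow_par_lt_gap; eauto; nia). nia.
Qed.

(** Here only [w - v >= 3 * v > 3 * d], so [k - j <= 3] is needed; this is why [2 <= i]. *)
Lemma three_share_pow3 a d s A i j k u v w :
  0 < d -> 2 <= i -> i < j -> j < k -> k <= 6 ->
  a + i * d = A + u -> a + j * d = A + v -> a + k * d = A + w ->
  pow_par 2 s u -> pow_par 2 s v -> pow_par 2 s w -> False.
Proof.
  intros.
  assert (0 < u) by (eapply (pow_par_pos 2); eauto; lia).
  assert (2 ^ 2 * v <= w) by (eapply pow_par_lt_gap; eauto; nia). nia.
Qed.

(** Wrong orders of the three terms fail at [lia], and the match then backtracks to another
    choice. *)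
Ltac shared A B :=
  match goal with
  | d0 : 0 < ?d, E1 : ?a + ?i * ?d = ?p1 + ?q1, E2 : ?a + ?j * ?d = ?p2 + ?q2,
    E3 : ?a + ?k * ?d = ?p3 + ?q3,
    A1 : ?p1 = A, A2 : ?p2 = A, A3 : ?p3 = A,
    W1 : pow_par 2 ?s ?q1, W2 : pow_par 2 ?s ?q2, W3 : pow_par 2 ?s ?q3 |- _ =>
    rewrite A1 in E1; rewrite A2 in E2; rewrite A3 in E3;
    apply (three_share_pow3 a d s A i j k q1 q2 q3 d0 ltac:(lia) ltac:(lia) ltac:(lia) ltac:(lia)
      E1 E2 E3 W1 W2 W3)
  | d0 : 0 < ?d, E1 : ?a + ?i * ?d = ?p1 + ?q1, E2 : ?a + ?j * ?d = ?p2 + ?q2,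
    E3 : ?a + ?k * ?d = ?p3 + ?q3,
    A1 : ?q1 = B, A2 : ?q2 = B, A3 : ?q3 = B,
    W1 : pow_par 3 ?s ?p1, W2 : pow_par 3 ?s ?p2, W3 : pow_par 3 ?s ?p3 |- _ =>
    rewrite A1 in E1; rewrite A2 in E2; rewrite A3 in E3;
    apply (three_share_pow2 a d s B i j k p1 p2 p3 d0 ltac:(lia) ltac:(lia) ltac:(lia) ltac:(lia)
      E1 E2 E3 W1 W2 W3)
  end.

Ltac cases A B H :=
  destruct H as (? & ? & ? & ? & ? & H);
  destruct H as [[[[? ?] | ?] [[? ?] | [? | ?]]] | [[? [? | [? | ?]]] | [? [? | [? | ?]]]]];
  try (exfalso; first [lia | shared A B]).

(* A disjunction left in the context would make [lia] split on it, so each term is introduced only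
   when it is case-split. *)
Lemma no_five a d r s : r = 0 \/ r = 1 -> s = 0 \/ s = 1 -> 2 <= a -> 24 <= d ->
  (forall k, 2 <= k <= 6 -> shape r s (a + k * d)) -> False.
Proof.
  intros Hr Hs Ha Hd H. assert (d0 : 0 < d) by lia.
  destruct (pow_par_top 3 r (a + 6 * d)) as (A & PA & MA); try lia.
  destruct (pow_par_top 2 s (a + 6 * d)) as (B & PB & MB); try lia.
  (* The bound [100 <= M] holds since [a + 6 * d >= 2 + 6 * 24]. *)
  assert (O : forall k, 2 <= k <= 6 -> _) by
   (intros k Hk; refine (shape_near_top r s (a + k * d) (a + 6 * d) A B PA PB MA MB _ _ (H k Hk)); nia).
  clear H PA PB Hr Hs.
  pose proof (O 6 ltac:(lia)) as O6; cases A B O6.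
  all: pose proof (O 5 ltac:(lia)) as O5; cases A B O5.
  all: pose proof (O 4 ltac:(lia)) as O4; cases A B O4.
  all: pose proof (O 3 ltac:(lia)) as O3; cases A B O3.
  all: pose proof (O 2 ltac:(lia)) as O2; cases A B O2.
Qed.

(** * Residues modulo 2, 3 and 8 *)

Lemma sum_ge2 n : sumset n -> 2 <= n.
Proof.
  intros (x & y & Hx & Hy & ->).
  pose proof (Z.pow_pos_nonneg 3 x). pose proof (Z.pow_pos_nonneg 2 y). lia.
Qed.

(** Used for [9 = 8 + 1] and [4 = 3 + 1]: the residues of [3 ^ x] modulo 8 and of [2 ^ y] modulo 3
    depend only on the parity of the exponent. *)
Lemma pow_succ_mod m n : 0 <= n -> exists k, (m + 1) ^ n = m * k + 1.
Proof.
  revert n. apply natlike_ind; [exists 0; lia |].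
  intros n Hn [k E]. exists (m * k + k + 1). rewrite Z.pow_succ_r, E by lia. lia.
Qed.

Lemma pow3_mod8 x : 0 <= x ->
  x mod 2 = 0 /\ 3 ^ x mod 8 = 1 \/ x mod 2 = 1 /\ 3 ^ x mod 8 = 3.
Proof.
  intros Hx. pose proof (Z.div_mod x 2).
  destruct (pow_succ_mod 8 (x / 2)) as [k Hk]; [Z.to_euclidean_division_equations; lia |].
  assert (x mod 2 = 0 \/ x mod 2 = 1) as [E | E] by (Z.to_euclidean_division_equations; lia);
    [left | right]; split; trivial;
    rewrite (Z.div_mod x 2), E, Z.pow_add_r, Z.pow_mul_r by (Z.to_euclidean_division_equations; lia);
    change (3 ^ 2) with (8 + 1); rewrite Hk; Z.to_euclidean_division_equations; lia.
Qed.

Lemma pow2_mod3 y : 0 <= y ->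
  y mod 2 = 0 /\ 2 ^ y mod 3 = 1 \/ y mod 2 = 1 /\ 2 ^ y mod 3 = 2.
Proof.
  intros Hy. pose proof (Z.div_mod y 2).
  destruct (pow_succ_mod 3 (y / 2)) as [k Hk]; [Z.to_euclidean_division_equations; lia |].
  assert (y mod 2 = 0 \/ y mod 2 = 1) as [E | E] by (Z.to_euclidean_division_equations; lia);
    [left | right]; split; trivial;
    rewrite (Z.div_mod y 2), E, Z.pow_add_r, Z.pow_mul_r by (Z.to_euclidean_division_equations; lia);
    change (2 ^ 2) with (3 + 1); rewrite Hk; Z.to_euclidean_division_equations; lia.
Qed.

Lemma pow3_mod3 x : 0 <= x -> x = 0 /\ 3 ^ x = 1 \/ 3 ^ x mod 3 = 0.
Proof.
  intros Hx. assert (x = 0 \/ 1 <= x) as [-> | H] by lia; [auto | right].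
  replace x with (1 + (x - 1)) by lia. rewrite Z.pow_add_r, Z.mul_comm by lia.
  apply Z_mod_mult.
Qed.

Lemma pow2_mod8 y : 0 <= y ->
  2 ^ y = 1 \/ y = 1 /\ 2 ^ y = 2 \/ 2 ^ y = 4 \/ 2 ^ y mod 8 = 0.
Proof.
  intros Hy. assert (y = 0 \/ y = 1 \/ y = 2 \/ 3 <= y) as [-> | [-> | [-> | H]]] by lia; auto.
  right; right; right.
  replace y with (3 + (y - 3)) by lia. rewrite Z.pow_add_r, Z.mul_comm by lia.
  apply Z_mod_mult.
Qed.

Lemma even_term n : sumset n -> n mod 2 = 0 -> exists x, 0 <= x /\ n = 3 ^ x + 1.
Proof.
  intros (x & y & Hx & Hy & ->) H. exists x. split; trivial.
  pose proof (pow3_mod8 x Hx). pose proof (pow2_mod8 y Hy).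
  Z.to_euclidean_division_equations; lia.
Qed.

(** Subtracting 1 leaves three equally spaced powers of 3, but the last gap is at least twice the
    middle power, hence larger than the first gap. *)
Lemma no_even_progression a d : 0 < d ->
  sumset a -> sumset (a + d) -> sumset (a + 2 * d) -> a mod 2 = 0 -> d mod 2 = 0 -> False.
Proof.
  intros Hd S0 S1 S2 Ha Hd2.
  apply even_term in S0 as (x & Hx & E0); trivial.
  apply even_term in S1 as (y & Hy & E1); [| Z.to_euclidean_division_equations; lia].
  apply even_term in S2 as (z & Hz & E2); [| Z.to_euclidean_division_equations; lia].
  pose proof (pow_lt_gap 3 y z). pose proof (Z.pow_pos_nonneg 3 x). lia.
Qed.

(** As 3 never divides [2 ^ y], it cannot divide [3 ^ x]; so [x = 0] and [2 ^ y] is 2 modulo 3. *)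
Lemma mult3_term n : sumset n -> n mod 3 = 0 -> exists q, pow_par 2 1 q /\ n = 1 + q.
Proof.
  intros (x & y & Hx & Hy & ->) H. exists (2 ^ y).
  pose proof (pow3_mod3 x Hx). pose proof (pow2_mod3 y Hy).
  split; [exists y; repeat split; trivial |];
  Z.to_euclidean_division_equations; lia.
Qed.

(* Both terms are [1 + 2^y] with [y] odd, so [3 d >= 3 * 2^y] and the first term is at most [1 + d]. *)
Lemma mult3_pair a d r : 2 <= a -> 0 < d -> 1 <= r ->
  sumset (a + r * d) -> sumset (a + (r + 3) * d) -> (a + r * d) mod 3 = 0 -> False.
Proof.
  intros Ha Hd Hr S0 S1 H.
  apply mult3_term in S0 as (p & Hp & E0); trivial.
  apply mult3_term in S1 as (q & Hq & E1).
  2: { rewrite <- H. replace (a + (r + 3) * d) with (a + r * d + d * 3) by ring.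
       apply Z_mod_plus_full. }
  pose proof (pow_par_lt_gap 2 1 p q ltac:(lia) Hp Hq). nia.
Qed.

(** [3 ^ x] is 1 or 3 modulo 8, and adding 1 or a multiple of 8 never gives 5 or 7. *)
Lemma term_mod8 n : sumset n -> n mod 8 = 5 \/ n mod 8 = 7 ->
  exists x c, 0 <= x /\ (c = 2 \/ c = 4) /\ n = 3 ^ x + c.
Proof.
  intros (x & y & Hx & Hy & ->) H. exists x, (2 ^ y).
  pose proof (pow3_mod8 x Hx). pose proof (pow2_mod8 y Hy).
  repeat split; trivial; Z.to_euclidean_division_equations; lia.
Qed.

(* Both terms are [3^x + c] with [c <= 4], so [(q - p) d] is about [2 * 3^x] or more, which exceeds
   the first term as [q - p <= p]. *)
Lemma mod8_pair a d p q : 2 <= a -> 6 <= d -> 0 < p -> p < q -> q <= 2 * p ->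
  sumset (a + p * d) -> sumset (a + q * d) ->
  (a + p * d) mod 8 = 5 \/ (a + p * d) mod 8 = 7 ->
  (a + q * d) mod 8 = 5 \/ (a + q * d) mod 8 = 7 -> False.
Proof.
  intros Ha Hd Hp Hpq Hq S0 S1 R0 R1.
  apply term_mod8 in S0 as (x & c & Hx & Hc & E0); trivial.
  apply term_mod8 in S1 as (y & c' & Hy & Hc' & E1); trivial.
  pose proof (pow_lt_gap 3 x y). pose proof (pow3_mod8 x Hx).
  assert (d <= (q - p) * d <= p * d) by nia.
  assert (E : 3 ^ y + c' = 3 ^ x + c + (q - p) * d) by lia.
  Z.to_euclidean_division_equations; lia.
Qed.

(** [r8 / 2] is the parity of [x] for which [3 ^ x] is [r8] modulo 8, and [r3 - 1] that of [y] for
    which [2 ^ y] is [r3] modulo 3. *)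
Lemma term_shape n r8 r3 : sumset n ->
  n mod 8 = r8 -> r8 = 1 \/ r8 = 3 -> n mod 3 = r3 -> r3 = 1 \/ r3 = 2 ->
  shape (r8 / 2) (r3 - 1) n.
Proof.
  intros (x & y & Hx & Hy & ->) E8 H8 E3 H3. exists (3 ^ x), (2 ^ y). split; trivial.
  pose proof (pow3_mod8 x Hx). pose proof (pow2_mod8 y Hy).
  pose proof (pow3_mod3 x Hx). pose proof (pow2_mod3 y Hy).
  assert (x mod 2 = r8 / 2 /\ y mod 2 = r3 - 1 \/ x mod 2 = 1 - r8 / 2 /\ 2 ^ y = 2
    \/ 3 ^ x = 1 /\ y mod 2 = 1 - (r3 - 1)) as [[] | [[] | []]].
  { destruct H8 as [-> | ->], H3 as [-> | ->];
    [change (1 / 2) with 0 | change (1 / 2) with 0 | change (3 / 2) with 1 | change (3 / 2) with 1];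
    Z.to_euclidean_division_equations; lia. }
  - left. split; eexists; eauto.
  - right; left. split; trivial. eexists; eauto.
  - right; right. split; trivial. eexists; eauto.
Qed.

(** * Divisibility of the difference by 24, and conclusion *)

Lemma no_progression7 a d : 0 < d -> (forall k, 0 <= k <= 6 -> sumset (a + k * d)) -> False.
Proof.
  intros Hd S.
  assert (Ha : 2 <= a) by (apply sum_ge2; replace a with (a + 0 * d) by lia; apply S; lia).
  assert (E : forall i k, 0 <= i -> 0 < k -> i + 2 * k <= 6 ->
    (a + i * d) mod 2 = 0 -> (k * d) mod 2 = 0 -> False).
  { intros i k Hi Hk Hik. apply no_even_progression; [nia | | |].
    - apply S; lia.
    - replace (a + i * d + k * d) with (a + (i + k) * d) by ring. apply S; lia.
    - replace (a + i * d + 2 * (k * d)) with (a + (i + 2 * k) * d) by ring. apply S; lia. }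
  assert (a mod 2 = 1 /\ d mod 2 = 0) as [A2 D2].
  (* Step 2 has even difference whatever [d] is, so neither [a] nor [a + d] is even. *)
  { pose proof (E 0 1). pose proof (E 0 2). pose proof (E 1 2).
    clear - H H0 H1. Z.to_euclidean_division_equations; lia. }
  assert (D3 : d mod 3 = 0).
  (* If 3 did not divide [d], it would divide one of three consecutive terms. *)
  { assert (T : forall r, 1 <= r <= 3 -> (a + r * d) mod 3 = 0 -> False)
      by (intros r Hr; apply (mult3_pair a d r); try apply S; lia).
    pose proof (T 1). pose proof (T 2). pose proof (T 3).
    clear - H H0 H1. Z.to_euclidean_division_equations; lia. }
  assert (Hd6 : 6 <= d) by (clear - Hd D2 D3; Z.to_euclidean_division_equations; lia).
  assert (P : forall p q, 0 < p -> p < q -> q <= 2 * p -> q <= 6 ->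
    (a + p * d) mod 8 = 5 \/ (a + p * d) mod 8 = 7 ->
    (a + q * d) mod 8 = 5 \/ (a + q * d) mod 8 = 7 -> False)
    by (intros p q **; apply (mod8_pair a d p q); try apply S; trivial; lia).
  (* Otherwise two terms admissible for [P] are 5 or 7 modulo 8: neighbours if [d] is 2 or 6 modulo
     8, terms two apart if it is 4, and all terms if it is 0 and [a] is 5 or 7. *)
  assert (D8 : d mod 8 = 0 /\ (a mod 8 = 1 \/ a mod 8 = 3)).
  { assert (R : forall k, (a + k * d) mod 8 = (a mod 8 + k * (d mod 8)) mod 8)
      by (intros k; rewrite <- (Z_mod_plus_full (a mod 8 + k * (d mod 8)) (a / 8 + k * (d / 8))); f_equal;
          rewrite (Z.div_mod a 8), (Z.div_mod d 8) at 1 by lia; ring).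
    assert (a mod 8 = 1 \/ a mod 8 = 3 \/ a mod 8 = 5 \/ a mod 8 = 7) as HA
      by (clear - A2; Z.to_euclidean_division_equations; lia).
    assert (d mod 8 = 0 \/ d mod 8 = 2 \/ d mod 8 = 4 \/ d mod 8 = 6) as HD
      by (clear - D2; Z.to_euclidean_division_equations; lia).
    destruct (Z.eq_dec (d mod 8) 0) as [D0 | D0];
      [destruct (Z_le_gt_dec (a mod 8) 3) as [A0 | A0]; [lia |] |]; exfalso;
      destruct HA as [e | [e | [e | e]]], HD as [e' | [e' | [e' | e']]]; try lia;
      rewrite e, e' in R;
      let pair p q := apply (P p q); rewrite ?R; solve [lia | auto] in
      first [ pair constr:(1) constr:(2) | pair constr:(2) constr:(3) | pair constr:(3) constr:(4)
            | pair constr:(4) constr:(5) | pair constr:(2) constr:(4) | pair constr:(3) constr:(5) ]. }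
  destruct D8 as [D8 A8].
  assert (A3 : a mod 3 = 1 \/ a mod 3 = 2).
  { assert ((a + 1 * d) mod 3 <> 0) by (intro; apply (mult3_pair a d 1); try apply S; trivial; lia).
    clear - H D3. Z.to_euclidean_division_equations; lia. }
  apply (no_five a d (a mod 8 / 2) (a mod 3 - 1)).
  - destruct A8 as [-> | ->]; auto.
  - lia.
  - trivial.
  - clear - Hd D3 D8. Z.to_euclidean_division_equations; lia.
  - intros k Hk. apply term_shape; trivial.
    + apply S; lia.
    + rewrite Z.add_mod, Z.mul_mod, D8, Z.mul_0_r, Z.add_0_r, !Z.mod_mod by lia. trivial.
    + rewrite Z.add_mod, Z.mul_mod, D3, Z.mul_0_r, Z.add_0_r, !Z.mod_mod by lia. trivial.
Qed.

Theorem theorem1p1 :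
  ~ (exists a d : Z, d <> 0 /\ forall k : Z, 0 <= k <= 6 -> sumset (a + k * d))
  /\ (forall (a d : Z) (L : nat),
        d <> 0 -> progression_in_sumset a d L -> (L <= 6)%nat).
Proof.
  assert (N : forall a d, d <> 0 -> (forall k, 0 <= k <= 6 -> sumset (a + k * d)) -> False).
  { intros a d Hd S. destruct (Z_lt_le_dec 0 d) as [Hd' | Hd'].
    - exact (no_progression7 a d Hd' S).
    - apply (no_progression7 (a + 6 * d) (- d)); [lia |].
      intros k Hk. replace (a + 6 * d + k * - d) with (a + (6 - k) * d) by ring. apply S; lia. }
  split.
  - intros (a & d & Hd & S). exact (N a d Hd S).
  - intros a d L Hd S. destruct (Nat.le_gt_cases L 6) as [H | H]; [trivial | exfalso].
    apply (N a d Hd). intros k Hk. rewrite <- (Z2Nat.id k) by lia. apply S. lia.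
Qed.
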